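(* Let $\mathcal{A},\mathcal{B}$ be small categories, $\mathcal{D}$ a category, $p,q,r,s$ non-negative integers, and let $D:\mathcal{A}^{(p,q)}\times\mathcal{B}^{(r,s)}\to\mathcal{D}$ be a functor. Then $${}_{(p+r,q+s)}\!\int_{(A,B)}D^{\mathbf A,\mathbf B}_{\mathbf A,\mathbf B}\;\cong\;{}_{(p,q)}\!\int_{A}\;{}_{(r,s)}\!\int_{B}D^{\mathbf A,\mathbf B}_{\mathbf A,\mathbf B}\;\cong\;{}_{(r,s)}\!\int_{B}\;{}_{(p,q)}\!\int_{A}D^{\mathbf A,\mathbf B}_{\mathbf A,\mathbf B},$$ $${}^{(p+r,q+s)}\!\int^{(A,B)}D^{\mathbf A,\mathbf B}_{\mathbf A,\mathbf B}\;\cong\;{}^{(p,q)}\!\int^{A}\;{}^{(r,s)}\!\int^{B}D^{\mathbf A,\mathbf B}_{\mathbf A,\mathbf B}\;\cong\;{}^{(r,s)}\!\int^{B}\;{}^{(p,q)}\!\int^{A}D^{\mathbf A,\mathbf B}_{\mathbf A,\mathbf B}$$ as objects of $\mathcal{D}$, meaning (in each of the two lines) that any of these expressions exists if and only if the others do, and, if so, they are all canonically isomorphic.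
   Context: For a category $\mathcal{C}$ write $\mathcal{C}^{(p,q)}=(\mathcal{C}^{\mathrm{op}})^p\times\mathcal{C}^q$. For a functor $T:\mathcal{C}^{(p,q)}\to\mathcal{D}$ and objects $A,B$ of $\mathcal C$ write $T^{\mathbf A}_{\mathbf B}=T(A,\dots,A;B,\dots,B)$ ($p$ contravariant entries $A$, $q$ covariant entries $B$). For $f:A\to B$ in $\mathcal{C}$ let $T^{\mathbf A}_{\mathbf f}:T^{\mathbf A}_{\mathbf A}\to T^{\mathbf A}_{\mathbf B}$ be induced by $f$ in all covariant entries and $T^{\mathbf f}_{\mathbf B}:T^{\mathbf B}_{\mathbf B}\to T^{\mathbf A}_{\mathbf B}$ by $f$ in all contravariant entries (and similarly $T^{\mathbf f}_{\mathbf A}:T^{\mathbf B}_{\mathbf A}\to T^{\mathbf A}_{\mathbf A}$, $T^{\mathbf B}_{\mathbf f}:T^{\mathbf B}_{\mathbf A}\to T^{\mathbf B}_{\mathbf B}$). A $(p,q)$-wedge for $T$ under $X\in\mathcal{D}$ is a family $\theta_A:X\to T^{\mathbf A}_{\mathbf A}$ ($A\in\mathcal C$) with $T^{\mathbf A}_{\mathbf f}\circ\theta_A=T^{\mathbf f}_{\mathbf B}\circ\theta_B$ for all $f:A\to B$. A $(p,q)$-cowedge for $T$ over $X$ is a family $\zeta_A:T^{\mathbf A}_{\mathbf A}\to X$ with $\zeta_A\circ T^{\mathbf f}_{\mathbf A}=\zeta_B\circ T^{\mathbf B}_{\mathbf f}$ for all $f:A\to B$. The $(p,q)$-end ${}_{(p,q)}\!\int_{A}T^{\mathbf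 A}_{\mathbf A}$ is, if it exists, the object carrying the universal (terminal) $(p,q)$-wedge; the $(p,q)$-coend ${}^{(p,q)}\!\int^{A}T^{\mathbf A}_{\mathbf A}$ is, if it exists, the object carrying the universal (initial) $(p,q)$-cowedge. For $D:\mathcal{A}^{(p,q)}\times\mathcal{B}^{(r,s)}\to\mathcal{D}$, the symbol $D^{\mathbf A,\mathbf B}_{\mathbf A,\mathbf B}$ denotes the value of $D$ when all $\mathcal A$-entries are $A$ and all $\mathcal B$-entries are $B$. In the iterated (co)ends, the inner one is taken pointwise with the other variables as parameters. The $(p+r,q+s)$-(co)end over $(A,B)$ is the one over the category $\mathcal{A}\times\mathcal{B}$ of the functor $(\mathcal{A}\times\mathcal{B})^{(p+r,q+s)}\to\mathcal{A}^{(p,q)}\times\mathcal{B}^{(r,s)}\xrightarrow{D}\mathcal{D}$, where the first functor keeps the $\mathcal A$-component of the first $p$ contravariant and first $q$ covariant entries and the $\mathcal B$-component of the last $r$ contravariant and last $s$ covariant entries.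
   Formalization: Existence of an iterated (co)end always gives the joint one; to conclude that an iterated (co)end exists from another expression, its pointwise inner (co)ends are assumed to exist at all parameters, since without this the claimed equivalence is false. *)

(* Defs.v *)
From mathcomp Require Import all_boot.
From Stdlib Require Import FunctionalExtensionality.

Set Implicit Arguments.
Unset Strict Implicit.
Unset Printing Implicit Defensive.

Declare Scope cat_scope.
Local Open Scope cat_scope.

Reserved Notation "g \oc f" (at level 50, left associativity).

Local Set Primitive Projections.

Record category := Category {
  obj :> Type;
  hom : obj -> obj -> Type;
  idm : forall x : obj, hom x x;
  compm : forall x y z : obj, hom y z -> hom x y -> hom x z;
  compm1 : forall (x y : obj) (f : hom x y), compm f (idm x) = f;
  comp1m : forall (x y : obj) (f : hom x y), compm (idm y) f = f;
  compmA : forall (x y z t : obj) (h : hom z t) (g : hom y z) (f : hom x y),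
    compm h (compm g f) = compm (compm h g) f
}.

Arguments hom {c} x y.
Arguments idm {c} x.
Arguments compm {c x y z} g f.

Notation "g \oc f" := (compm g f) : cat_scope.

Definition is_iso (C : category) (x y : C) (f : hom x y) : Prop :=
  exists g : hom y x, g \oc f = idm x /\ f \oc g = idm y.

Record functor (C D : category) := Functor {
  fobj :> C -> D;
  fmap : forall x y : C, hom x y -> hom (fobj x) (fobj y);
  fmap1 : forall x : C, fmap (idm x) = idm (fobj x);
  fmapM : forall (x y z : C) (g : hom y z) (f : hom x y),
    fmap (g \oc f) = fmap g \oc fmap f
}.

Local Unset Primitive Projections.

Arguments fmap {C D} _ {x y} _.

Definition op (C : category) : category :=
  {| obj := C;
     hom := fun x y => @hom C y x;
     idm := fun x => @idm C x;
     compm := fun x y z g f => @compm C z y x f g;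
     compm1 := fun x y f => @comp1m C y x f;
     comp1m := fun x y f => @compm1 C y x f;
     compmA := fun x y z t h g f => esym (@compmA C t z y x f g h) |}.

Definition prodc (C D : category) : category.
Proof.
refine {| obj := C * D;
          hom := fun x y => (hom x.1 y.1 * hom x.2 y.2)%type;
          idm := fun x => (idm x.1, idm x.2);
          compm := fun x y z g f => (g.1 \oc f.1, g.2 \oc f.2) |}.
- by move=> x y [f1 f2] /=; rewrite !compm1.
- by move=> x y [f1 f2] /=; rewrite !comp1m.
- by move=> x y z t h g f /=; rewrite !compmA.
Defined.

Definition powc (C : category) (n : nat) : category.
Proof.
refine {| obj := 'I_n -> C;
          hom := fun x y => forall i, hom (x i) (y i);
          idm := fun x i => idm (x i);
          compm := fun x y z g f i => g i \oc f i |}.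
- by move=> x y f; apply: functional_extensionality_dep => i; apply: compm1.
- by move=> x y f; apply: functional_extensionality_dep => i; apply: comp1m.
- by move=> x y z t h g f; apply: functional_extensionality_dep => i;
    apply: compmA.
Defined.

(* C^(p,q) = (C^op)^p x C^q *)
Definition mixed (C : category) (p q : nat) : category :=
  prodc (powc (op C) p) (powc C q).

(* (A,...,A; B,...,B), with p contravariant A's and q covariant B's *)
Definition diag (C : category) (p q : nat) (A B : C) : mixed C p q :=
  (fun _ => A, fun _ => B).

Arguments diag {C} p q A B.

Definition diagm (C : category) (p q : nat) (A A' B B' : C)
    (f : hom A' A) (g : hom B B') : hom (diag p q A B) (diag p q A' B') :=
  (fun _ => f, fun _ => g).

Arguments diagm {C} p q {A A' B B'} f g.

Section Ends.
Variables (C D : category) (p q : nat) (T : functor (mixed C p q) D).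

Definition is_wedge (X : D) (theta : forall A : C, hom X (T (diag p q A A))) :=
  forall (A B : C) (f : hom A B),
    fmap T (diagm p q (idm A) f) \oc theta A =
    fmap T (diagm p q f (idm B)) \oc theta B.

Definition is_end (X : D) (theta : forall A : C, hom X (T (diag p q A A))) :=
  is_wedge theta /\
  forall (Y : D) (zeta : forall A : C, hom Y (T (diag p q A A))),
    is_wedge zeta ->
    exists! u : hom Y X, forall A : C, theta A \oc u = zeta A.

Definition has_end : Prop :=
  exists (X : D) (theta : forall A : C, hom X (T (diag p q A A))), is_end theta.

Definition is_cowedge (X : D) (zeta : forall A : C, hom (T (diag p q A A)) X) :=
  forall (A B : C) (f : hom A B),
    zeta A \oc fmap T (diagm p q f (idm A)) =
    zeta B \oc fmap T (diagm p q (idm B) f).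

Definition is_coend (X : D) (zeta : forall A : C, hom (T (diag p q A A)) X) :=
  is_cowedge zeta /\
  forall (Y : D) (theta : forall A : C, hom (T (diag p q A A)) Y),
    is_cowedge theta ->
    exists! u : hom X Y, forall A : C, u \oc zeta A = theta A.

Definition has_coend : Prop :=
  exists (X : D) (zeta : forall A : C, hom (T (diag p q A A)) X),
    is_coend zeta.

End Ends.

Section Bifunctors.
Variables X Y Z : category.

(* D(x, -) *)
Definition fixl (D : functor (prodc X Y) Z) (x : X) : functor Y Z.
Proof.
refine {| fobj := fun y : Y => D ((x, y) : prodc X Y);
          fmap := fun y y' g =>
            @fmap _ _ D (x, y) (x, y') (idm x, g) |}.
- by move=> y; apply: (@fmap1 _ _ D (x, y)).
- by move=> y y' y'' g f; rewrite -fmapM /= compm1.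
Defined.

Definition swapf (D : functor (prodc X Y) Z) : functor (prodc Y X) Z.
Proof.
refine {| fobj := fun z : prodc Y X => D ((z.2, z.1) : prodc X Y);
          fmap := fun z z' g =>
            @fmap _ _ D (z.2, z.1) (z'.2, z'.1) (g.2, g.1) |}.
- by move=> z; apply: (@fmap1 _ _ D (z.2, z.1)).
- by move=> z z' z'' g f; rewrite -fmapM.
Defined.

End Bifunctors.

Section PointwiseEnds.
Variables (X B Z : category) (r s : nat).
Variable D : functor (prodc X (mixed B r s)) Z.

Definition has_pointwise_end : Prop := forall x : X, has_end (fixl D x).

(* E is the functor x |-> end over b of D(x, -): naturality of the universal
   wedges is what determines E on morphisms. *)
Definition is_pointwise_end (E : functor X Z)
    (w : forall (x : X) (b : B), hom (E x) (fixl D x (diag r s b b))) : Prop :=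
  (forall x : X, is_end (w x)) /\
  forall (x x' : X) (h : hom x x') (b : B),
    w x' b \oc fmap E h =
    @fmap _ _ D (x, diag r s b b) (x', diag r s b b) (h, idm (diag r s b b))
      \oc w x b.

Definition has_pointwise_coend : Prop := forall x : X, has_coend (fixl D x).

Definition is_pointwise_coend (E : functor X Z)
    (w : forall (x : X) (b : B), hom (fixl D x (diag r s b b)) (E x)) : Prop :=
  (forall x : X, is_coend (w x)) /\
  forall (x x' : X) (h : hom x x') (b : B),
    fmap E h \oc w x b =
    w x' b \oc
      @fmap _ _ D (x, diag r s b b) (x', diag r s b b) (h, idm (diag r s b b)).

End PointwiseEnds.

Section Fubini.
Variables (A B Z : category) (p q r s : nat).

(* (A x B)^(p+r,q+s) -> A^(p,q) x B^(r,s) *)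
Definition splitc : functor (mixed (prodc A B) (p + r) (q + s))
                            (prodc (mixed A p q) (mixed B r s)).
Proof.
refine {| fobj := fun z : mixed (prodc A B) (p + r) (q + s) =>
    (((fun i => (z.1 (lshift r i)).1, fun j => (z.2 (lshift s j)).1),
      (fun i => (z.1 (rshift p i)).2, fun j => (z.2 (rshift q j)).2))
     : prodc (mixed A p q) (mixed B r s));
  fmap := fun z z' h =>
    ((fun i => (h.1 (lshift r i)).1, fun j => (h.2 (lshift s j)).1),
     (fun i => (h.1 (rshift p i)).2, fun j => (h.2 (rshift q j)).2)) |}.
- by [].
- by [].
Defined.

Variable D : functor (prodc (mixed A p q) (mixed B r s)) Z.

Definition joint : functor (mixed (prodc A B) (p + r) (q + s)) Z.
Proof.
refine {| fobj := fun z => D (splitc z);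
          fmap := fun z z' h => fmap D (fmap splitc h) |}.
- by move=> z; rewrite !fmap1.
- by move=> z z' z'' g f; rewrite !fmapM.
Defined.

(* D with all A-entries equal to a and all B-entries equal to b; it is
   convertible to the value of [joint] on the diagonal at (a, b). *)
Definition diag2 (a : A) (b : B) : Z := D (diag p q a a, diag r s b b).

Definition is_iter_end (X : Z) (pi : forall a b, hom X (diag2 a b)) : Prop :=
  exists (E : functor (mixed A p q) Z)
         (w : forall (x : mixed A p q) (b : B),
            hom (E x) (fixl D x (diag r s b b)))
         (theta : forall a : A, hom X (E (diag p q a a))),
    [/\ is_pointwise_end w, is_end theta
      & forall a b, pi a b = w (diag p q a a) b \oc theta a].

(* This includes the existence of the inner end of D(x, -) at every x, not only
   at the diagonal ones. *)
Definition has_iter_end : Prop :=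
  exists (X : Z) (pi : forall a b, hom X (diag2 a b)), is_iter_end pi.

Definition is_iter_coend (X : Z) (pi : forall a b, hom (diag2 a b) X) : Prop :=
  exists (E : functor (mixed A p q) Z)
         (w : forall (x : mixed A p q) (b : B),
            hom (fixl D x (diag r s b b)) (E x))
         (zeta : forall a : A, hom (E (diag p q a a)) X),
    [/\ is_pointwise_coend w, is_coend zeta
      & forall a b, pi a b = zeta a \oc w (diag p q a a) b].

Definition has_iter_coend : Prop :=
  exists (X : Z) (pi : forall a b, hom (diag2 a b) X), is_iter_coend pi.

Definition is_joint_end (X : Z) (pi : forall a b, hom X (diag2 a b)) : Prop :=
  @is_end _ _ (p + r) (q + s) joint X (fun c : prodc A B => pi c.1 c.2).

Definition is_joint_coend (X : Z) (pi : forall a b, hom (diag2 a b) X) : Prop :=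
  @is_coend _ _ (p + r) (q + s) joint X (fun c : prodc A B => pi c.1 c.2).

(* The canonical isomorphisms: those compatible with the maps to (from) the
   diagonal values of D, which moreover determine them. *)
Definition canonically_iso_over (X Y : Z)
    (pi : forall a b, hom X (diag2 a b)) (rho : forall a b, hom Y (diag2 a b)) :=
  exists u : hom X Y,
    [/\ is_iso u, forall a b, rho a b \oc u = pi a b
      & forall v : hom X Y, (forall a b, rho a b \oc v = pi a b) -> v = u].

Definition canonically_iso_under (X Y : Z)
    (pi : forall a b, hom (diag2 a b) X) (rho : forall a b, hom (diag2 a b) Y) :=
  exists u : hom X Y,
    [/\ is_iso u, forall a b, u \oc pi a b = rho a b
      & forall v : hom X Y, (forall a b, v \oc pi a b = rho a b) -> v = u].

End Fubini.

(* Main.v *)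
Require Import Defs.
From mathcomp Require Import all_boot.
From Stdlib Require Import IndefiniteDescription.

(** A wedge over the product category is the same thing as a family indexed by
pairs (a, b) that is a wedge in a for each b and a wedge in b for each a: a
pair of morphisms (f, g) is the composite of (f, id) and (id, g), and D of a
pair factors accordingly, in either order.  So the joint end of D is the
universal such family, called a biend below ([joint_endP]).  The notion of
biend treats A and B alike, hence it does not see the exchange of the two
groups of variables ([swap_biendP]).

The iterated end is a biend as well.  Let w_x : E x -> D(x, -) be the inner
ends.  Families theta_a : X -> E(a, a) correspond to families
pi_{a,b} = w_{(a,a),b} o theta_a that are wedges in b, by the universal property
of E(a, a).  Since E acts on morphisms by naturality of w, the wedge condition
on theta, tested against the jointly monic maps w_{(a,a'),b}, is exactly the
wedge condition of pi in a ([wedge_biwedgeP]).  Therefore theta is universal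
if and only if pi is ([end_biendP]).  Conversely, once the inner ends exist at
all x they assemble into a functor ([pointwise_end_functor]), and any biend
factors through them as an iterated end ([biend_iter_end]).  All the claims
about ends follow: existence is carried along these equivalences, and two
biends are isomorphic by a unique map that respects the projections.

The statements about coends are the ones about ends for the functor D read
between the opposite categories. *)

Set Implicit Arguments.
Unset Strict Implicit.
Unset Printing Implicit Defensive.

Local Open Scope cat_scope.

(** * Choice and cancellation *)

Lemma choose_family (I : Type) (T : I -> Type) (P : forall i, T i -> Prop) :
  (forall i, exists x, P i x) -> exists f : forall i, T i, forall i, P i (f i).
Proof.
move=> exP.
have c i := constructive_indefinite_description _ (exP i).
by exists (fun i => sval (c i)) => i; case: (c i).
Qed.

(** The projections of an end are jointly monic: a map into the end is
determined by the wedge it induces. *)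
Lemma end_mono (C Z : category) (p q : nat) (T : functor (mixed C p q) Z)
    (X : Z) (theta : forall a : C, hom X (T (diag p q a a))) :
  is_end theta -> forall (Y : Z) (u v : hom Y X),
    (forall a, theta a \oc u = theta a \oc v) -> u = v.
Proof.
move=> [wedge_th univ] Y u v uv.
have [|t [_ uniq_t]] := univ Y (fun a => theta a \oc u).
  by move=> a b f; rewrite !compmA wedge_th.
by rewrite -(uniq_t u) // -(uniq_t v).
Qed.

(** * The action of a functor of two variables on pairs of morphisms *)

Section Bimap.
Variables (X Y Z : category) (D : functor (prodc X Y) Z).

Definition bimap (x x' : X) (y y' : Y) (h : hom x x') (g : hom y y') :
    hom (D (x, y)) (D (x', y')) :=
  @fmap _ _ D (x, y) (x', y') (h, g).

Lemma bimap_splitl (x x' : X) (y y' : Y) (h : hom x x') (g : hom y y') :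
  bimap h g = bimap h (idm y') \oc bimap (idm x) g.
Proof. by rewrite /bimap -fmapM /= compm1 comp1m. Qed.

Lemma bimap_splitr (x x' : X) (y y' : Y) (h : hom x x') (g : hom y y') :
  bimap h g = bimap (idm x') g \oc bimap h (idm y).
Proof. by rewrite /bimap -fmapM /= compm1 comp1m. Qed.

Lemma bimapMl (x x' x'' : X) (y : Y) (k : hom x' x'') (h : hom x x') :
  bimap (k \oc h) (idm y) = bimap k (idm y) \oc bimap h (idm y).
Proof. by rewrite /bimap -fmapM /= compm1. Qed.

Lemma bimap1 (x : X) (y : Y) : bimap (idm x) (idm y) = idm (D (x, y)).
Proof. exact: (@fmap1 _ _ D (x, y)). Qed.

End Bimap.

(** * Biends and joint ends *)

Section Biend.
Variables (A B Z : category) (p q r s : nat).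
Variable D : functor (prodc (mixed A p q) (mixed B r s)) Z.

Definition wedge_left (X : Z) (pi : forall a b, hom X (diag2 D a b)) : Prop :=
  forall b (a a' : A) (f : hom a a'),
    bimap D (diagm p q (idm a) f) (idm (diag r s b b)) \oc pi a b =
    bimap D (diagm p q f (idm a')) (idm (diag r s b b)) \oc pi a' b.

Definition wedge_right (X : Z) (pi : forall a b, hom X (diag2 D a b)) : Prop :=
  forall a (b b' : B) (g : hom b b'),
    bimap D (idm (diag p q a a)) (diagm r s (idm b) g) \oc pi a b =
    bimap D (idm (diag p q a a)) (diagm r s g (idm b')) \oc pi a b'.

Definition is_biwedge (X : Z) (pi : forall a b, hom X (diag2 D a b)) : Prop :=
  wedge_left pi /\ wedge_right pi.

Definition is_biend (X : Z) (pi : forall a b, hom X (diag2 D a b)) : Prop :=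
  is_biwedge pi /\
  forall (Y : Z) (zeta : forall a b, hom Y (diag2 D a b)), is_biwedge zeta ->
    exists! u : hom Y X, forall a b, pi a b \oc u = zeta a b.

(** The wedge condition along (f, id) and (id, g) gives the two separate
conditions.  For the converse, the condition along (f, g) is reached by
exchanging g first and f next, with [bimap_splitl] and [bimap_splitr] bringing
the relevant factor next to the family. *)
Lemma joint_wedgeP (X : Z)
    (theta : forall c : prodc A B,
       hom X (joint D (diag (p + r) (q + s) c c))) :
  is_wedge theta <-> is_biwedge (fun a b => theta (a, b)).
Proof.
split=> [wedge_th | [wl wr] [a b] [a' b'] [f g]].
  split=> [b a a' f | a b b' g].
    exact: (wedge_th (a, b) (a', b) (f, idm b)).
  exact: (wedge_th (a, b) (a, b') (idm a, g)).
(* The value of joint D on diagonal morphisms computes to a bimap. *)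
change (bimap D (diagm p q (idm a) f) (diagm r s (idm b) g) \oc theta (a, b) =
  bimap D (diagm p q f (idm a')) (diagm r s g (idm b')) \oc theta (a', b')).
rewrite bimap_splitl -compmA wr compmA -bimap_splitl bimap_splitr.
by rewrite -compmA wl compmA -bimap_splitr.
Qed.

Lemma joint_endP (X : Z)
    (theta : forall c : prodc A B,
       hom X (joint D (diag (p + r) (q + s) c c))) :
  is_end theta <-> is_biend (fun a b => theta (a, b)).
Proof.
split=> [] [/joint_wedgeP wth univ]; split=> // Y zeta.
  move=> wz; have [|u [uz uniq_u]] := univ Y (fun c => zeta c.1 c.2).
    exact/joint_wedgeP.
  by exists u; split=> [a b | v vz]; [exact: (uz (a, b)) |
    apply: uniq_u => -[]].
move=> /joint_wedgeP/univ[u [uz uniq_u]].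
by exists u; split=> [[a b] | v vz]; [exact: uz |
  apply: uniq_u => a b; exact: (vz (a, b))].
Qed.

Lemma biend_canonically_iso (X Y : Z)
    (pi : forall a b, hom X (diag2 D a b))
    (rho : forall a b, hom Y (diag2 D a b)) :
  is_biend pi -> is_biend rho -> canonically_iso_over pi rho.
Proof.
move=> [wpi upi] [wrho urho].
have [u [ru uniq_u]] := urho X pi wpi; have [v [pv _]] := upi Y rho wrho.
have [i [_ uniq_i]] := upi X pi wpi; have [j [_ uniq_j]] := urho Y rho wrho.
exists u; split=> // [|k rk]; last by rewrite (uniq_u k).
exists v; split.
  rewrite -(uniq_i (v \oc u)) => [|a b]; last by rewrite compmA pv ru.
  by apply: uniq_i => a b; rewrite compm1.
rewrite -(uniq_j (u \oc v)) => [|a b]; last by rewrite compmA ru pv.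
by apply: uniq_j => a b; rewrite compm1.
Qed.

(** * Iterated ends are biends *)

Section Inner.
Variables (E : functor (mixed A p q) Z)
          (w : forall (x : mixed A p q) (b : B),
             hom (E x) (fixl D x (diag r s b b))).
Hypothesis Ew : is_pointwise_end w.

Lemma inner_natural (x x' : mixed A p q) (h : hom x x') (b : B) :
  w x' b \oc fmap E h = bimap D h (idm (diag r s b b)) \oc w x b.
Proof. by case: Ew. Qed.

Lemma inner_mono (x : mixed A p q) (Y : Z) (u v : hom Y (E x)) :
  (forall b, w x b \oc u = w x b \oc v) -> u = v.
Proof. by case: Ew => endw _; apply: end_mono (endw x) _ _ _. Qed.

(** Being a wedge in b is automatic for a family that factors through the inner
ends.  Being a wedge in a is, after cancelling the jointly monic projections of
the inner end at the off-diagonal object (a, a'), the wedge condition of theta: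
this is why the inner ends are needed away from the diagonal. *)
Lemma wedge_biwedgeP (X : Z) (theta : forall a, hom X (E (diag p q a a)))
    (pi : forall a b, hom X (diag2 D a b)) :
  (forall a b, pi a b = w (diag p q a a) b \oc theta a) ->
  is_wedge theta <-> is_biwedge pi.
Proof.
move=> pi_th; split=> [wth | [wl _] a a' f].
  split=> [b a a' f | a b b' g]; rewrite !pi_th !compmA.
    by rewrite -!inner_natural -!compmA wth.
  by have [wx _] := Ew.1 (diag p q a a); congr (_ \oc _); exact: wx.
by apply: inner_mono => b; rewrite !compmA !inner_natural -!compmA -!pi_th wl.
Qed.

Lemma biwedge_factor (X : Z) (pi : forall a b, hom X (diag2 D a b)) :
  is_biwedge pi -> exists theta : forall a, hom X (E (diag p q a a)),
    forall a b, pi a b = w (diag p q a a) b \oc theta a.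
Proof.
move=> [_ wr]; apply: (choose_family (P := fun a t =>
  forall b, pi a b = w (diag p q a a) b \oc t)) => a.
have [_ univ] := Ew.1 (diag p q a a).
have [|t [wt _]] := univ X (pi a); first exact: wr.
by exists t => b; rewrite wt.
Qed.

(** By [wedge_biwedgeP] and [biwedge_factor], theta and pi receive the same
families from any test object, so that they are universal together. *)
Lemma end_biendP (X : Z) (theta : forall a, hom X (E (diag p q a a)))
    (pi : forall a b, hom X (diag2 D a b)) :
  (forall a b, pi a b = w (diag p q a a) b \oc theta a) ->
  is_end theta <-> is_biend pi.
Proof.
move=> pi_th; split=> [] [wth univ]; split; try exact/(wedge_biwedgeP pi_th).
  move=> Y zeta wz; have [eta zeta_eta] := biwedge_factor wz.
  have [|u [u_eta uniq_u]] := univ Y eta; first exact/(wedge_biwedgeP zeta_eta).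
  exists u; split=> [a b | v vz].
    by rewrite pi_th -compmA u_eta zeta_eta.
  by apply: uniq_u => a; apply: inner_mono => b;
      rewrite compmA -pi_th vz zeta_eta.
move=> Y eta weta.
have [|u [uz uniq_u]] := univ Y (fun a b => w (diag p q a a) b \oc eta a).
  exact/(wedge_biwedgeP (fun _ _ => erefl)).
exists u; split=> [a | v veta].
  by apply: inner_mono => b; rewrite compmA -pi_th uz.
by apply: uniq_u => a b; rewrite pi_th -compmA veta.
Qed.

End Inner.

Lemma iter_end_biend (X : Z) (pi : forall a b, hom X (diag2 D a b)) :
  is_iter_end pi -> is_biend pi.
Proof.
by move=> [E [w [theta [Ew th pi_th]]]]; apply/(end_biendP Ew pi_th).
Qed.

(** A morphism h : x -> x' turns the universal wedge of D(x, -) into a wedge of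
D(x', -), because D(h, id) commutes with D(id, k); the induced map is the value
of E on h.  Functoriality is uniqueness of induced maps. *)
Lemma pointwise_end_functor : has_pointwise_end D ->
  exists (E : functor (mixed A p q) Z)
         (w : forall (x : mixed A p q) (b : B),
            hom (E x) (fixl D x (diag r s b b))), is_pointwise_end w.
Proof.
move=> /choose_family[E0 /choose_family[w endw]].
(* The choice of induced maps ranges over all morphisms at once, bundled with
   their source and target. *)
have exm (k : {x : mixed A p q & {x' : mixed A p q & hom x x'}}) :
    exists u : hom (E0 (tag k)) (E0 (tag (tagged k))), forall b,
      w _ b \oc u = bimap D (tagged (tagged k)) (idm _) \oc w _ b.
  case: k => x [x' h] /=; have [_ univ] := endw x'.
  have [|u [wu _]] := univ _ (fun b => bimap D h (idm _) \oc w x b);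
    last by exists u.
  move=> b b' g; have [wx _] := endw x; rewrite !compmA.
  have nat_h y y' (k : hom y y') : fmap (fixl D x') k \oc bimap D h (idm y) =
      bimap D h (idm y') \oc fmap (fixl D x) k.
    exact: etrans (esym (bimap_splitr D h k)) (bimap_splitl D h k).
  by rewrite !nat_h -!compmA wx.
have [m mE] := choose_family exm.
pose E1 x x' (h : hom x x') := m (Tagged _ (Tagged _ h)).
have wE x x' (h : hom x x') b :
  w x' b \oc E1 x x' h = bimap D h (idm _) \oc w x b := mE _ b.
have E11 x : E1 x x (idm x) = idm (E0 x).
  by apply: end_mono (endw x) _ _ _ _ => b; rewrite wE bimap1 comp1m compm1.
have E1M x y z (g : hom y z) (f : hom x y) :
    E1 x z (g \oc f) = E1 y z g \oc E1 x y f.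
  apply: end_mono (endw z) _ _ _ _ => b.
  rewrite compmA !wE bimapMl -!compmA; congr (_ \oc _).
  exact: esym (wE _ _ f b).
by exists (Functor E11 E1M), w; split=> // x x' h b; exact: wE.
Qed.

Lemma biend_iter_end (X : Z) (pi : forall a b, hom X (diag2 D a b)) :
  has_pointwise_end D -> is_biend pi -> is_iter_end pi.
Proof.
move=> /pointwise_end_functor[E [w Ew]] bi.
have [theta pi_th] := biwedge_factor Ew bi.1.
by exists E, w, theta; split=> //; apply/(end_biendP Ew pi_th).
Qed.

End Biend.

(** The two halves of the wedge condition are exchanged, and the functor
swapf D takes on swapped pairs the very values of D. *)
Lemma swap_biendP (A B Z : category) (p q r s : nat)
    (D : functor (prodc (mixed A p q) (mixed B r s)) Z) (X : Z)
    (sigma : forall b a, hom X (diag2 (swapf D) b a)) :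
  is_biend sigma <-> is_biend (D := D) (fun a b => sigma b a).
Proof.
split=> [] [[wl wr] univ]; split=> // Y zeta [zl zr].
  have [//|u [uz uniq_u]] := univ Y (fun b a => zeta a b); exists u.
  by split=> [a b | v vz]; [exact: uz | apply: uniq_u => b a; exact: vz].
have [//|u [uz uniq_u]] := univ Y (fun a b => zeta b a); exists u.
by split=> [b a | v vz]; [exact: uz | apply: uniq_u => a b; exact: vz].
Qed.

(** * Duality *)

(** The categories op (mixed C p q) and mixed (op C) p q have convertible
objects, morphisms and compositions, but different proofs of the laws.  Dual
functors are therefore rebuilt with the intended source, from the data of the
given functor. *)
Definition dual_mixed (C Z : category) (p q : nat)
  (T : functor (mixed C p q) Z) : functor (mixed (op C) p q) (op Z) :=
  {| fobj := fun x : mixed (op C) p q => T x : op Z;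
     fmap := fun x y h => @fmap _ _ T y x h;
     fmap1 := fun x => @fmap1 _ _ T x;
     fmapM := fun x y z g f => @fmapM _ _ T z y x f g |}.

Definition undual_mixed (C Z : category) (p q : nat)
  (T : functor (mixed (op C) p q) (op Z)) : functor (mixed C p q) Z :=
  {| fobj := fun x : mixed C p q => T x : Z;
     fmap := fun x y h => @fmap _ _ T y x h;
     fmap1 := fun x => @fmap1 _ _ T x;
     fmapM := fun x y z g f => @fmapM _ _ T z y x f g |}.

Definition dual2 (A B Z : category) (p q r s : nat)
  (D : functor (prodc (mixed A p q) (mixed B r s)) Z) :
    functor (prodc (mixed (op A) p q) (mixed (op B) r s)) (op Z) :=
  {| fobj := fun x : prodc (mixed (op A) p q) (mixed (op B) r s) => D x : op Z;
     fmap := fun x y h => @fmap _ _ D y x h;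
     fmap1 := fun x => @fmap1 _ _ D x;
     fmapM := fun x y z g f => @fmapM _ _ D z y x f g |}.

(** Reversing the arrows exchanges the two sides of the equation for f. *)
Lemma dual_wedgeP (C Z : category) (p q : nat) (T : functor (mixed C p q) Z)
    (X : Z) (zeta : forall a : C, hom (T (diag p q a a)) X) :
  is_cowedge zeta <-> @is_wedge _ _ p q (dual_mixed T) X zeta.
Proof. by split=> wz a b f; symmetry; apply: wz. Qed.

Lemma dual_endP (C Z : category) (p q : nat) (T : functor (mixed C p q) Z)
    (X : Z) (zeta : forall a : C, hom (T (diag p q a a)) X) :
  is_coend zeta <-> @is_end _ _ p q (dual_mixed T) X zeta.
Proof.
split=> [] [/dual_wedgeP wz univ]; split=> // Y theta /dual_wedgeP; exact: univ.
Qed.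

(** * Bicoends *)

Section Bicoend.
Variables (A B Z : category) (p q r s : nat).
Variable D : functor (prodc (mixed A p q) (mixed B r s)) Z.

Definition is_bicoend (X : Z) (pi : forall a b, hom (diag2 D a b) X) : Prop :=
  @is_biend _ _ _ p q r s (dual2 D) X pi.

Lemma joint_coendP (X : Z)
    (zeta : forall c : prodc A B,
       hom (joint D (diag (p + r) (q + s) c c)) X) :
  is_coend zeta <-> is_bicoend (fun a b => zeta (a, b)).
Proof.
by split=> [/dual_endP h | h]; [| apply/dual_endP];
  apply/(@joint_endP _ _ _ p q r s (dual2 D)).
Qed.

Lemma bicoend_canonically_iso (X Y : Z)
    (pi : forall a b, hom (diag2 D a b) X)
    (rho : forall a b, hom (diag2 D a b) Y) :
  is_bicoend pi -> is_bicoend rho -> canonically_iso_under pi rho.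
Proof.
move=> bpi brho.
have [u [[v [vu uv]] ru uniq_u]] := biend_canonically_iso brho bpi.
by exists u; split=> //; exists v.
Qed.

(** The naturality squares that define E on morphisms are those of the
dual functor, with source and target exchanged. *)
Lemma dual_pointwise_coendP (E : functor (mixed A p q) Z)
    (w : forall (x : mixed A p q) (b : B),
       hom (fixl D x (diag r s b b)) (E x)) :
  is_pointwise_coend w <->
  @is_pointwise_end (mixed (op A) p q) (op B) (op Z) r s (dual2 D)
    (dual_mixed E) w.
Proof.
have coend_end x := dual_endP (T := fixl D x) (w x).
split=> [] [cw nat_w]; split=> [x | x x' h b].
- by apply/(coend_end x).1/cw.
- exact: (nat_w x' x h b).
- by apply/(coend_end x).2/cw.
- exact: (nat_w x' x h b).
Qed.

Lemma iter_coend_bicoend (X : Z) (pi : forall a b, hom (diag2 D a b) X) :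
  is_iter_coend pi -> is_bicoend pi.
Proof.
move=> [E [w [zeta [/dual_pointwise_coendP Ew /dual_endP cz pi_z]]]].
by apply: iter_end_biend; exists (dual_mixed E), w, zeta.
Qed.

Lemma bicoend_iter_coend (X : Z) (pi : forall a b, hom (diag2 D a b) X) :
  has_pointwise_coend D -> is_bicoend pi -> is_iter_coend pi.
Proof.
move=> pw bi.
have [|E [w [theta [Ew th pi_th]]]] := biend_iter_end _ bi.
  by move=> x; have [Y [z /dual_endP cz]] := pw x; exists Y, z.
exists (undual_mixed E), w, theta; split=> //; last exact/dual_endP.
exact/dual_pointwise_coendP.
Qed.

End Bicoend.

Lemma swap_bicoendP (A B Z : category) (p q r s : nat)
    (D : functor (prodc (mixed A p q) (mixed B r s)) Z) (X : Z)
    (sigma : forall b a, hom (diag2 (swapf D) b a) X) :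
  is_bicoend sigma <-> is_bicoend (D := D) (fun a b => sigma b a).
Proof. exact: (@swap_biendP _ _ _ p q r s (dual2 D) X sigma). Qed.

(** * Existence *)

Section Existence.
Variables (A B Z : category) (p q r s : nat).
Variable D : functor (prodc (mixed A p q) (mixed B r s)) Z.

Lemma has_joint_endP : has_end (joint D) <->
  exists (X : Z) (pi : forall a b, hom X (diag2 D a b)), is_biend pi.
Proof.
split=> [] [X [pi bi]]; exists X.
  by exists (fun a b => pi (a, b)); apply/joint_endP.
by exists (fun c => pi c.1 c.2); apply/joint_endP.
Qed.

Lemma iter_end_joint_end : has_iter_end D -> has_end (joint D).
Proof.
by move=> [X [pi /iter_end_biend bi]]; apply/has_joint_endP; exists X, pi.
Qed.

Lemma joint_end_iter_end :
  has_pointwise_end D -> has_end (joint D) -> has_iter_end D.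
Proof.
by move=> pw /has_joint_endP[X [pi bi]]; exists X, pi; apply: biend_iter_end.
Qed.

Lemma has_joint_coendP : has_coend (joint D) <->
  exists (X : Z) (pi : forall a b, hom (diag2 D a b) X), is_bicoend pi.
Proof.
split=> [] [X [pi bi]]; exists X.
  by exists (fun a b => pi (a, b)); apply/joint_coendP.
by exists (fun c => pi c.1 c.2); apply/joint_coendP.
Qed.

Lemma iter_coend_joint_coend : has_iter_coend D -> has_coend (joint D).
Proof.
by move=> [X [pi /iter_coend_bicoend bi]]; apply/has_joint_coendP; exists X, pi.
Qed.

Lemma joint_coend_iter_coend :
  has_pointwise_coend D -> has_coend (joint D) -> has_iter_coend D.
Proof.
by move=> pw /has_joint_coendP[X [pi bi]]; exists X, pi;
  apply: bicoend_iter_coend.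
Qed.

End Existence.

Lemma swap_joint_end (A B Z : category) (p q r s : nat)
    (D : functor (prodc (mixed A p q) (mixed B r s)) Z) :
  has_end (joint (swapf D)) <-> has_end (joint D).
Proof.
split=> /has_joint_endP[X [pi bi]]; apply/has_joint_endP; exists X.
  by exists (fun a b => pi b a); apply/swap_biendP.
by exists (fun b a => pi a b); apply/swap_biendP.
Qed.

Lemma swap_joint_coend (A B Z : category) (p q r s : nat)
    (D : functor (prodc (mixed A p q) (mixed B r s)) Z) :
  has_coend (joint (swapf D)) <-> has_coend (joint D).
Proof.
split=> /has_joint_coendP[X [pi bi]]; apply/has_joint_coendP; exists X.
  by exists (fun a b => pi b a); apply/swap_bicoendP.
by exists (fun b a => pi a b); apply/swap_bicoendP.
Qed.

Theorem theorem3p16 (A B Z : category) (p q r s : nat)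
    (D : functor (prodc (mixed A p q) (mixed B r s)) Z) :
  ([/\ has_iter_end D -> has_end (joint D),
       has_iter_end (swapf D) -> has_end (joint D),
       has_pointwise_end D -> (has_end (joint D) <-> has_iter_end D),
       has_pointwise_end (swapf D) ->
         (has_end (joint D) <-> has_iter_end (swapf D))
     & has_pointwise_end D -> has_pointwise_end (swapf D) ->
         (has_iter_end D <-> has_iter_end (swapf D))] /\
   (forall (X Y W : Z)
           (pi : forall (a : A) (b : B), hom X (diag2 D a b))
           (rho : forall (a : A) (b : B), hom Y (diag2 D a b))
           (sigma : forall (b : B) (a : A), hom W (diag2 (swapf D) b a)),
      [/\ is_joint_end pi -> is_iter_end rho -> canonically_iso_over pi rho,
          is_joint_end pi -> is_iter_end sigma ->
            canonically_iso_over pi (fun a b => sigma b a)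
        & is_iter_end rho -> is_iter_end sigma ->
            canonically_iso_over rho (fun a b => sigma b a)])) /\
  ([/\ has_iter_coend D -> has_coend (joint D),
       has_iter_coend (swapf D) -> has_coend (joint D),
       has_pointwise_coend D -> (has_coend (joint D) <-> has_iter_coend D),
       has_pointwise_coend (swapf D) ->
         (has_coend (joint D) <-> has_iter_coend (swapf D))
     & has_pointwise_coend D -> has_pointwise_coend (swapf D) ->
         (has_iter_coend D <-> has_iter_coend (swapf D))] /\
   (forall (X Y W : Z)
           (pi : forall (a : A) (b : B), hom (diag2 D a b) X)
           (rho : forall (a : A) (b : B), hom (diag2 D a b) Y)
           (sigma : forall (b : B) (a : A), hom (diag2 (swapf D) b a) W),
      [/\ is_joint_coend pi -> is_iter_coend rho -> canonically_iso_under pi rho,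
          is_joint_coend pi -> is_iter_coend sigma ->
            canonically_iso_under pi (fun a b => sigma b a)
        & is_iter_coend rho -> is_iter_coend sigma ->
            canonically_iso_under rho (fun a b => sigma b a)])).
Proof.
have end_swap := swap_joint_end D; have coend_swap := swap_joint_coend D.
split; split.
- have toL := @iter_end_joint_end _ _ _ _ _ _ _ D.
  have toR := @iter_end_joint_end _ _ _ _ _ _ _ (swapf D).
  have ofL := @joint_end_iter_end _ _ _ _ _ _ _ D.
  have ofR := @joint_end_iter_end _ _ _ _ _ _ _ (swapf D).
  by split; tauto.
- move=> X Y W pi rho sigma; split.
  + by move=> /joint_endP bpi /iter_end_biend; apply: biend_canonically_iso.
  + move=> /joint_endP bpi /iter_end_biend/swap_biendP.
    exact: biend_canonically_iso.
  + move=> /iter_end_biend brho /iter_end_biend/swap_biendP.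
    exact: biend_canonically_iso.
- have toL := @iter_coend_joint_coend _ _ _ _ _ _ _ D.
  have toR := @iter_coend_joint_coend _ _ _ _ _ _ _ (swapf D).
  have ofL := @joint_coend_iter_coend _ _ _ _ _ _ _ D.
  have ofR := @joint_coend_iter_coend _ _ _ _ _ _ _ (swapf D).
  by split; tauto.
- move=> X Y W pi rho sigma; split.
  + move=> /joint_coendP bpi /iter_coend_bicoend.
    exact: bicoend_canonically_iso.
  + move=> /joint_coendP bpi /iter_coend_bicoend/swap_bicoendP.
    exact: bicoend_canonically_iso.
  + move=> /iter_coend_bicoend brho /iter_coend_bicoend/swap_bicoendP.
    exact: bicoend_canonically_iso.
Qed.
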